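(* Let $n\ge3$ and $r\ge1$ be integers. The algebraic multiplicity of the eigenvalue $0$ of $A_{n,r}$ equals $$\mathrm{ord}_x\Phi_{n,r}=rn-2r+2-n\Bigl\lfloor\frac{r+2}{3}\Bigr\rfloor =\begin{cases} \dfrac{1}{3}(2n-6)(r-1), & r\equiv 1\pmod 3,\\[2mm] \dfrac{1}{3}(2n-6)(r-2)+(n-2), & r\equiv 2\pmod 3,\\[2mm] \dfrac{1}{3}(2n-6)(r-3)+2(n-2), & r\equiv 0\pmod 3. \end{cases}$$
   Context: For integers $n\ge3$ and $r\ge1$, the digraph $\Gamma_{n,r}$ has vertex set $V(\Gamma_{n,r})=\{1,2,\dots,rn-2r+2\}$ and directed edge set $E(\Gamma_{n,r})$ defined by $E(\Gamma_{n,1})=\{(j,j+1):1\le j\le n-1\}\cup\{(n,1)\}$; $E(\Gamma_{n,2})=E(\Gamma_{n,1})\cup\{(1,n+1)\}\cup\{(j,j+1):n+1\le j\le 2n-3\}\cup\{(2n-2,n)\}$; and for $r\ge3$, $E(\Gamma_{n,r})=E(\Gamma_{n,2})\cup\bigcup_{i=1}^{r-2}F_i$, where $F_i=\{(in-2i+2,\,in+n-2i+1)\}\cup\{(j,j+1):in+n-2i+1\le j\le in+2n-2i-3\}\cup\{(in+2n-2i-2,\,in+n-2i)\}$. (For $n=3$ the middle path parts are empty.) The adjacency matrix $A_{n,r}$ is the $(0,1)$-matrix indexed by $V(\Gamma_{n,r})$ whose $(u,v)$-entry is $1$ if and only if $(u,v)\in E(\Gamma_{n,r})$, and $\Phi_{n,r}=\det(xI-A_{n,r})\in\mathbb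 Z[x]$. For $\Phi\in\mathbb Z[x]$, $\mathrm{ord}_x\Phi$ denotes the order of vanishing of $\Phi$ at $x=0$ (multiplicity $0$ means that $0$ is not an eigenvalue). *)

(* Defs.v *)
From mathcomp Require Import all_boot all_order all_algebra all_field.

Set Implicit Arguments.
Unset Strict Implicit.
Unset Printing Implicit Defensive.

Import Order.TTheory GRing.Theory Num.Theory.

Local Open Scope nat_scope.

(* The edge sets are relations on the labels 1, 2, ..., r n - 2 r + 2.  They are
   meant for 3 <= n, and then no subtraction below is truncated. *)

Definition edges1 (n : nat) : rel nat := fun u v =>
  ((1 <= u <= n - 1) && (v == u + 1)) || ((u == n) && (v == 1)).

Definition edges2 (n : nat) : rel nat := fun u v =>
  [|| edges1 n u v,
      (u == 1) && (v == n + 1),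
      (n + 1 <= u <= 2 * n - 3) && (v == u + 1)
    | (u == 2 * n - 2) && (v == n)].

Definition edgesF (n i : nat) : rel nat := fun u v =>
  [|| (u == i * n - 2 * i + 2) && (v == i * n + n - 2 * i + 1),
      (i * n + n - 2 * i + 1 <= u <= i * n + 2 * n - 2 * i - 3)
        && (v == u + 1)
    | (u == i * n + 2 * n - 2 * i - 2) && (v == i * n + n - 2 * i)].

Definition edges (n r : nat) : rel nat := fun u v =>
  if r <= 1 then edges1 n u v
  else if r == 2 then edges2 n u v
  else edges2 n u v || has (fun i => edgesF n i u v) (iota 1 (r - 2)).

Definition num_vertices (n r : nat) : nat := r * n - 2 * r + 2.

(* Ordinals start at 0: the ordinal i stands for the vertex i + 1. *)
Definition Gamma (n r : nat) : rel 'I_(num_vertices n r) :=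
  fun u v => edges n r u.+1 v.+1.

Definition adjacency (n r : nat) : 'M[int]_(num_vertices n r) :=
  \matrix_(u, v) (Gamma u v)%:R%R.

Definition Phi (n r : nat) : {poly int} := char_poly (adjacency n r).

(* The least k such that the coefficient of 'X^k in p is nonzero, for p != 0.
   The library's root multiplicity [mup] requires coefficients in a field. *)
Definition ordX (R : nzRingType) (p : {poly R}) : nat :=
  find (fun c : R => c != 0%R) p.

Definition alg_mult (F : fieldType) (m : nat) (a : F) (A : 'M[F]_m) : nat :=
  mup a (char_poly A).

(* Main.v *)
Require Import Defs.
From mathcomp Require Import all_boot all_order all_algebra all_field.
From mathcomp Require Import perm zify ring.

Set Implicit Arguments.
Unset Strict Implicit.
Unset Printing Implicit Defensive.

Import Order.TTheory GRing.Theory Num.Theory.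
Local Open Scope ring_scope.

(** The digraph is a row of [r] directed [n]-cycles.  With vertices counted from
    0, [n = e + 3] and [d = e + 1], put [c_0 = 0] and [c_k = k d + 1] for
    [k >= 1].  These hubs form the directed path [c_r -> ... -> c_1 -> c_0], and
    the ear number [k >= 1] leaves [c_(k-1)], runs through the [d] vertices
    following [c_k], the last of which is [c_(k+1)], and so ends in [c_(k+1) ->
    c_k].  Ear number 0 is the first cycle, from [c_0 = 0] through [1, ..., d + 1]
    and back.  The only simple cycles are the [n]-cycles closed by the ears, and
    two of them are disjoint exactly when their numbers differ by at least 3.
    Every family of [k] disjoint cycles contributes [(-1)^k x^(N - k n)] to the
    characteristic polynomial, [N] being the number of vertices, so there is no
    cancellation: the lowest power comes from the largest families, which have
    [floor((r + 2) / 3)] members.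

    The proof obtains the polynomial by elimination instead of enumerating
    cycles.  The last vertex of the graph has a single edge to earlier vertices;
    [eliminate_last] removes such a vertex from a determinant without dividing,
    at the price of changing the column of the target of this edge.  Removing a
    whole ear ([eliminate_ear]) leaves a determinant of the same shape for a
    graph with one ear less, in which the column of the last hub depends on
    three parameters [u], [w], [y].  As the determinant is linear in them, it is
    given by three coefficients that obey the linear recursion [det_coefs].
    Over three consecutive steps of this recursion the order of vanishing at 0
    and the sign of the lowest coefficient follow a pattern
    ([det_coefs_lowest_term]) in which terms of equal order always add up with
    equal signs; this is the absence of cancellation mentioned above. *)

(** * Determinants of the leading square corners of an infinite array *)

(** Arrays are indexed by [nat], so that deleting the last row and column only
    changes the size [N]: no ordinal has to be cast. *)
Definition corner_det {R : comNzRingType} (N : nat) (f : nat -> nat -> R) : R :=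
  \det (\matrix_(i < N, j < N) f i j).

Definition set_col {R : Type} (c : nat) (g : nat -> R) (f : nat -> nat -> R) :
  nat -> nat -> R := fun i j => if (j == c)%N then g i else f i j.

Lemma eq_corner_det (R : comNzRingType) N (f g : nat -> nat -> R) :
  (forall i j, (i < N)%N -> (j < N)%N -> f i j = g i j) ->
  corner_det N f = corner_det N g.
Proof. by move=> fg; congr (\det _); apply/matrixP=> i j; rewrite !mxE fg. Qed.

Lemma corner_det_last_row (R : comNzRingType) N (f : nat -> nat -> R) :
  (forall j, (j < N)%N -> f N j = 0) ->
  corner_det N.+1 f = f N N * corner_det N f.
Proof.
move=> fN0; rewrite /corner_det (expand_det_row _ ord_max) big_ord_recr /=.
rewrite big1 => [|j _]; last by rewrite mxE /= fN0 ?mul0r.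
rewrite add0r mxE /= /cofactor addnn -signr_odd odd_double expr0 mul1r.
congr (_ * \det _); apply/matrixP=> i j; rewrite !mxE.
by rewrite !lift_max.
Qed.

Lemma corner_det_swap_last (R : comNzRingType) N c (f : nat -> nat -> R) :
  (c < N)%N ->
  corner_det N.+1 f
  = - corner_det N.+1 (set_col N (f^~ c) (set_col c (f^~ N) f)).
Proof.
move=> lt_cN; pose co := Ordinal (ltnW lt_cN : (c < N.+1)%N).
have co_max : co != ord_max by rewrite -val_eqE /= neq_ltn lt_cN.
rewrite /corner_det; set A := \matrix_(i, j) f i j; set B := (X in - \det X).
suff -> : B = xcol co ord_max A.
  by rewrite xcolE det_mulmx det_perm odd_tperm co_max expr1 mulrN1 opprK.
apply/matrixP=> i j; rewrite !mxE /set_col.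
case: tpermP => [->|->|/eqP jc /eqP jm] /=.
- by rewrite (ltn_eqF lt_cN) eqxx.
- by rewrite eqxx.
- by move: jc jm; rewrite -!val_eqE /= => /negPf-> /negPf->.
Qed.

Lemma corner_det_row_linear (R : comNzRingType) N k (a b : R)
    (f g h : nat -> nat -> R) : (k < N)%N ->
  (forall j, (j < N)%N -> f k j = a * g k j + b * h k j) ->
  (forall i j, i != k -> g i j = f i j) ->
  (forall i j, i != k -> h i j = f i j) ->
  corner_det N f = a * corner_det N g + b * corner_det N h.
Proof.
move=> kN fk gf hf; apply: (determinant_multilinear (i0 := Ordinal kN)).
- by apply/rowP=> j; rewrite !mxE /= fk.
- apply/matrixP=> i j; rewrite !mxE gf //.
  by have := neq_lift (Ordinal kN) i; rewrite -val_eqE eq_sym.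
- apply/matrixP=> i j; rewrite !mxE hf //.
  by have := neq_lift (Ordinal kN) i; rewrite -val_eqE eq_sym.
Qed.

Lemma corner_det_tr (R : comNzRingType) N (f : nat -> nat -> R) :
  corner_det N (fun i j => f j i) = corner_det N f.
Proof.
by rewrite /corner_det -det_tr; congr (\det _); apply/matrixP=> i j; rewrite !mxE.
Qed.

Lemma corner_det_col_linear (R : comNzRingType) N k (a b : R) (g h : nat -> R)
    (f : nat -> nat -> R) : (k < N)%N ->
  corner_det N (set_col k (fun i => a * g i + b * h i) f)
  = a * corner_det N (set_col k g f) + b * corner_det N (set_col k h f).
Proof.
move=> kN; rewrite -!(corner_det_tr _ (set_col _ _ _)).
by apply: corner_det_row_linear kN _ _ _ => [j _|i j /negPf ik|i j /negPf ik];
  rewrite /set_col ?eqxx ?ik.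
Qed.

(** Expand along the last row, which has at most two nonzero entries: the
    diagonal one leaves the corner itself, and the one in column [c] leaves,
    after exchanging the columns [c] and [N], minus the corner with column [c]
    replaced by column [N].  Multilinearity in column [c] puts the two together. *)
Lemma eliminate_last (R : comNzRingType) N c (f : nat -> nat -> R) :
  (c < N)%N -> (forall j, (j < N)%N -> j != c -> f N j = 0) ->
  corner_det N.+1 f
  = corner_det N (set_col c (fun i => f N N * f i c - f N c * f i N) f).
Proof.
move=> lt_cN fN0.
pose unit_row k i j : R := if (i == N)%N then (j == k)%N%:R else f i j.
rewrite (corner_det_row_linear (k := N) (a := f N N) (b := f N c)
  (g := unit_row N) (h := unit_row c)) //.
- rewrite (corner_det_swap_last (unit_row c) lt_cN).
  rewrite !corner_det_last_row.
  + have -> : corner_det N (set_col c (fun i => f N N * f i c - f N c * f i N) f)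
      = corner_det N (set_col c (fun i => f N N * f i c + (- f N c) * f i N) f).
      by apply: eq_corner_det => i j _ _; rewrite /set_col mulNr.
    rewrite corner_det_col_linear // /unit_row /set_col !eqxx !mul1r.
    rewrite mulNr mulrN; congr (_ * _ - _ * _); apply: eq_corner_det => i j iN jN.
      by rewrite (ltn_eqF iN); case: eqP => // ->.
    by rewrite (ltn_eqF iN) (ltn_eqF jN).
  + move=> j jN; rewrite /set_col /unit_row (ltn_eqF jN) !eqxx.
    by case: (eqVneq j c) => [_|_] //; rewrite (gtn_eqF lt_cN).
  + by move=> j jN; rewrite /unit_row eqxx (ltn_eqF jN).
- move=> j; rewrite ltnS /unit_row eqxx => jN.
  case: (eqVneq j N) => [->|jneN].
    by rewrite (gtn_eqF lt_cN) mulr1 mulr0 addr0.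
  case: (eqVneq j c) => [->|jnc]; first by rewrite mulr0 add0r mulr1.
  by rewrite !mulr0 addr0 fN0 // ltn_neqAle jneN.
- by move=> i j /negPf iN; rewrite /unit_row iN.
- by move=> i j /negPf iN; rewrite /unit_row iN.
Qed.

(** * Eliminating an ear of a digraph *)

Definition char_entry {R : comNzRingType} (A : rel nat) (x : R) (i j : nat) : R :=
  x *+ (i == j) - (A i j)%:R.

(** A path that leaves the vertex [p] and goes on through [c + 1], [c + 2], ...;
    [p] counts as its vertex number 0. *)
Definition path_vertex (c p t : nat) : nat := if t is 0 then p else (c + t)%N.

Lemma path_vertexP c p t :
  t = 0 /\ path_vertex c p t = p \/ (0 < t)%N /\ path_vertex c p t = (c + t)%N.
Proof. by case: t => [|t]; [left|right]. Qed.

(** Only edges among the vertices up to [c + t + 1] are constrained: the later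
    vertices are eliminated before this one. *)
Definition pendant_path (A : rel nat) (c p l : nat) : Prop :=
  forall t, (t < l)%N ->
    (forall j, (j <= c + t.+1)%N -> A (c + t.+1)%N j = false) /\
    (forall i, (i < c + t.+1)%N -> A i (c + t.+1)%N = (i == path_vertex c p t)).

(** The term in [u] means that the end of the path is joined to [c] by an edge of
    weight [u].  Eliminating that end makes the previous vertex of the path the
    source of this edge and multiplies the rest of column [c] by the pivot [x];
    at last the edge starts at [p]. *)
Lemma eliminate_path (R : comNzRingType) (A : rel nat) (x u : R) (c p l : nat)
    (g : nat -> R) :
  (p <= c)%N -> pendant_path A c p l ->
  (forall i, (c < i <= c + l)%N -> g i = 0) ->
  corner_det (c + l).+1
    (set_col c (fun i => g i - u *+ (i == path_vertex c p l)) (char_entry A x))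
  = corner_det c.+1
      (set_col c (fun i => x ^+ l * g i - u *+ (i == p)) (char_entry A x)).
Proof.
move=> le_pc; elim: l g => [|l IHl] g pathA g0.
  by rewrite addn0; apply: eq_corner_det => i j _ _; rewrite /set_col expr0 mul1r.
have [rowN colN] := pathA l (ltnSn l).
have pathA' : pendant_path A c p l by move=> t tl; apply: pathA; apply: ltnW.
have neqc : (c + l.+1 == c)%N = false by lia.
rewrite (eliminate_last (c := c)); first 1 last.
- lia.
- move=> j jN jc; rewrite /set_col (negPf jc) /char_entry rowN ?(ltnW jN) //.
  by rewrite (gtn_eqF jN) subr0.
rewrite exprS [path_vertex c p l.+1]/=.
under eq_corner_det => i j iN jN.
  rewrite (_ : set_col c _ _ i j = set_col c
    (fun i => x * g i - u *+ (i == path_vertex c p l)) (char_entry A x) i j); last first.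
    rewrite /set_col; case: (j == c) => //=.
    rewrite !eqxx neqc (g0 (c + l.+1)%N); last by lia.
    rewrite (ltn_eqF iN) /char_entry eqxx rowN // colN // (ltn_eqF iN).
    by case: (i == path_vertex c p l); rewrite ?mulr1n ?mulr0n; ring.
  over.
rewrite addnS IHl //.
  by apply: eq_corner_det => i j _ _; rewrite /set_col; case: eqP => // _; ring.
by move=> i hi; rewrite g0 ?mulr0 //; lia.
Qed.

(** The path is followed by a further vertex [c + l + 1], which closes the cycle
    by an edge to [c]. *)
Definition ear (A : rel nat) (c p l : nat) : Prop :=
  [/\ (p <= c)%N, pendant_path A c p l,
      forall j, (j <= (c + l).+1)%N -> A (c + l).+1 j = (j == c)
    & forall i, (i < (c + l).+1)%N -> A i (c + l).+1 = (i == path_vertex c p l)].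

(** The end of the ear carries a modified column: diagonal entry [y], weight [u]
    on its incoming edges, and an additional edge of weight [w] from [c].  It is
    eliminated with pivot [y]; then [eliminate_path] applies. *)
Lemma eliminate_ear (R : comNzRingType) (A : rel nat) (x u w y : R) (c p l : nat) :
  ear A c p l ->
  corner_det (c + l).+2
    (set_col (c + l).+1
       (fun i => if i == (c + l).+1 then y
                 else - (u *+ A i (c + l).+1 + w *+ (i == c)))
       (char_entry A x))
  = corner_det c.+1
      (set_col c (fun i => x ^+ l * (y * char_entry A x i c - w *+ (i == c))
                           - u *+ (i == p))
         (char_entry A x)).
Proof.
move=> [le_pc pathA rowN colN].
have cN : (c < (c + l).+1)%N by lia.
rewrite (eliminate_last cN) => [|j jN jc]; last first.
  rewrite /set_col (ltn_eqF jN) /char_entry rowN ?(ltnW jN) //.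
  by rewrite (gtn_eqF jN) (negPf jc) subr0.
rewrite -(eliminate_path _ _
  (g := fun i => y * char_entry A x i c - w *+ (i == c))) //.
  apply: eq_corner_det => i j iN jN; rewrite /set_col.
  case: (j == c); last by rewrite (ltn_eqF jN).
  rewrite !eqxx (ltn_eqF iN) (ltn_eqF cN) {2}/char_entry rowN ?(ltnW cN) // eqxx.
  rewrite (gtn_eqF cN) colN // mulr0n mulr1n; ring.
move=> i hi; have [t [it tl]] : exists t, i = (c + t.+1)%N /\ (t < l)%N.
  by exists (i - c.+1)%N; lia.
have [rowi _] := pathA t tl; rewrite it /char_entry rowi; last by lia.
by rewrite (_ : (c + t.+1 == c)%N = false) ?subr0 ?mulr0 ?subr0 //; lia.
Qed.

(** * The recursion along a chain of ears *)

(** The vertices [c_k] at which the cycles meet.  The first ear has one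
    intermediate vertex more than the others, which puts [c_0] at 0 and not at
    the value 1 of the general formula. *)
Definition hub (e k : nat) : nat := if k is 0 then 0 else (k * e.+1).+1.

Lemma hubSS e k : hub e k.+2 = (hub e k.+1 + e).+1.
Proof. by rewrite /hub; lia. Qed.

Lemma leq_hub e k l : (k <= l)%N -> (hub e k <= hub e l)%N.
Proof. by case: l k => [|l] [|k] //; rewrite /hub => ?; nia. Qed.

Lemma hub_gap e k l : (k < l)%N -> (hub e k + e.+1 <= hub e l)%N.
Proof. by case: l => // l; rewrite /hub; case: k => [|k]; nia. Qed.

(** The family of determinants stable under removing an ear: up to the last hub,
    only the column of that hub differs from the characteristic matrix.  The
    characteristic determinant is the case [u = 1], [w = 0], [y = x]. *)
Definition last_hub_det {R : comNzRingType} (A : rel nat) (e : nat) (x : R)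
    (s : nat) (u w y : R) : R :=
  corner_det (hub e s).+1
    (set_col (hub e s)
       (fun i => if i == hub e s then y
                 else - (u *+ A i (hub e s) + w *+ (i == hub e s.-1)))
       (char_entry A x)).

(** The first ear starts at the vertex 0 to which it returns, whence the repeated
    0. *)
Definition ear_chain (A : rel nat) (e r : nat) : Prop :=
  [/\ A 0 0 = false, ear A 0 0 e.+1
    & forall k, (k.+1 < r)%N -> ear A (hub e k.+1) (hub e k) e].

Lemma last_hub_det1 (R : comNzRingType) A e r (x u w y : R) :
  ear_chain A e r ->
  last_hub_det A e x 1 u w y = x ^+ e.+1 * (y * x - w) - u.
Proof.
move=> [A00 ear0 _]; rewrite /last_hub_det.
have -> : hub e 1 = (0 + e.+1).+1 by rewrite /hub mul1n.
rewrite (eliminate_ear _ _ _ _ ear0) /corner_det det_mx11 mxE.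
by rewrite /set_col /char_entry A00 /= subr0 !mulr1n.
Qed.

Lemma hub_loopless A e r s :
  ear_chain A e r -> (s <= r)%N -> A (hub e s) (hub e s) = false.
Proof.
move=> [A00 [_ _ row0 _] ears]; case: s => [//|[_|s lt_sr]].
  have -> : hub e 1 = (0 + e.+1).+1 by rewrite /hub mul1n.
  by rewrite row0.
by have [_ _ rowN _] := ears s lt_sr; rewrite hubSS rowN //; lia.
Qed.

(** In the column of the previous hub, the diagonal [x] and the incoming edge are
    multiplied by the pivots [y] and [x ^+ e] of the ear, the edge of weight [w]
    becomes a loop, and the ear itself is contracted to an edge of weight [u]
    from the hub before. *)
Lemma last_hub_detSS (R : comNzRingType) A e r (x u w y : R) s :
  ear_chain A e r -> (s.+1 < r)%N ->
  last_hub_det A e x s.+2 u w y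
  = last_hub_det A e x s.+1 (x ^+ e * y) u (x ^+ e * (y * x - w)).
Proof.
move=> chain lt_sr; have Acc := hub_loopless chain (ltnW lt_sr).
have [_ _ ears] := chain; have ear_s := ears s lt_sr.
rewrite /last_hub_det hubSS (eliminate_ear _ _ _ _ ear_s) [s.+1.-1]/=.
have lt_hub : (hub e s < hub e s.+1)%N.
  by apply: leq_trans (hub_gap e (ltnSn s)); rewrite addnS ltnS leq_addr.
apply: eq_corner_det => i j iN jN.
rewrite /set_col; case: (j == _) => //.
case: (eqVneq i (hub e s.+1)) => [->|ic].
  by rewrite (gtn_eqF lt_hub) /char_entry eqxx Acc mulr1n mulr0n !subr0.
by rewrite /char_entry (negPf ic) !mulr0n; ring.
Qed.

Lemma char_det_chain (R : comNzRingType) A e r (x : R) s :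
  ear_chain A e r -> (s <= r)%N ->
  corner_det (hub e s).+1 (char_entry A x) = last_hub_det A e x s 1 0 x.
Proof.
move=> chain le_sr; have Acc := hub_loopless chain le_sr.
apply: eq_corner_det => i j _ _; rewrite /set_col.
case: (eqVneq j (hub e s)) => // ->; rewrite /char_entry mul0rn addr0.
by case: eqP => [->|_]; rewrite ?Acc ?subr0 // sub0r.
Qed.

(** The coefficients of [y], [- w] and [- u] in [last_hub_det] at [s + 1] ears;
    the recursion is the transpose of the parameter change in
    [last_hub_detSS]. *)
Fixpoint det_coefs {R : comNzRingType} (e : nat) (x : R) (s : nat) : R * R * R :=
  if s is s'.+1 then
    let: (a, b, c) := det_coefs e x s' in
    (x ^+ e.+1 * a - x ^+ e * c, x ^+ e * a, b)
  else (x ^+ e.+2, x ^+ e.+1, 1).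

Lemma last_hub_detE (R : comNzRingType) A e r (x u w y : R) s :
  ear_chain A e r -> (s < r)%N ->
  last_hub_det A e x s.+1 u w y
  = let: (a, b, c) := det_coefs e x s in y * a - w * b - u * c.
Proof.
move=> chain; elim: s u w y => [|s IHs] u w y lt_sr.
  by rewrite (last_hub_det1 _ _ _ _ chain) /= !exprS; ring.
rewrite (last_hub_detSS _ _ _ _ chain) // IHs; last exact: ltnW.
by rewrite /=; case: (det_coefs e x s) => [[a b] c]; rewrite !exprS; ring.
Qed.

(** * The digraph as a chain of ears *)

Definition ear_edge (e k i j : nat) : Prop :=
  let c := hub e k.+1 in
  [\/ i = hub e k /\ j = c.+1,
      (c < i <= c + e)%N /\ j = i.+1
    | i = (c + e).+1 /\ j = c].

(** Written in terms of hubs, the edges that the second cycle adds to the first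
    and those that each later cycle adds follow the same pattern. *)
Lemma edgesP e r i j : (0 < r)%N ->
  edges e.+3 r i.+1 j.+1 <->
  [\/ (i <= e.+1)%N /\ j = i.+1,
      i = e.+2 /\ j = 0
    | exists2 k, (k.+1 < r)%N & ear_edge e k i j].
Proof.
move=> r_gt0.
have E1 : edges1 e.+3 i.+1 j.+1 <-> (i <= e.+1)%N /\ j = i.+1 \/ i = e.+2 /\ j = 0.
  by rewrite /edges1; lia.
have E2 : edges2 e.+3 i.+1 j.+1 <-> edges1 e.+3 i.+1 j.+1 \/ ear_edge e 0 i j.
  have -> : ear_edge e 0 i j <-> [\/ i = 0 /\ j = (1 * e.+1).+2,
      ((1 * e.+1).+1 < i <= (1 * e.+1).+1 + e)%N /\ j = i.+1
    | i = ((1 * e.+1).+1 + e).+1 /\ j = (1 * e.+1).+1] by [].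
  rewrite /edges2; case: edges1; first by split=> // _; left.
  rewrite orFb; split=> [h|[//|]]; last by case; lia.
  by right; case/or3P: h => h; [apply: Or31|apply: Or32|apply: Or33]; lia.
have EF k : edgesF e.+3 k.+1 i.+1 j.+1 <-> ear_edge e k.+1 i j.
  rewrite /edgesF /ear_edge /hub; split.
    by case/or3P=> h; [apply: Or31|apply: Or32|apply: Or33]; lia.
  by case; lia.
rewrite /edges; case: leqP => [r1|r_gt1].
  rewrite E1; split=> [[h|h]|[h|h|[k]]]; [exact: Or31|exact: Or32|by left|by right|lia].
have E2' : edges2 e.+3 i.+1 j.+1 <-> [\/ (i <= e.+1)%N /\ j = i.+1,
    i = e.+2 /\ j = 0 | ear_edge e 0 i j].
  rewrite E2 E1; split; first by case=> [[]|]; [exact: Or31|exact: Or32|exact: Or33].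
  by case; [left; left|left; right|right].
case: eqP => [r2|r_neq2].
  rewrite E2'; split=> [[h|h|h]|[h|h|[[|k] // kr h]]].
  - exact: Or31.
  - exact: Or32.
  - by apply: Or33; exists 0; rewrite ?r2.
  - exact: Or31.
  - exact: Or32.
  - exact: Or33.
  - by lia.
split=> [/orP[/E2'[h|h|h]|/hasP[k kr kF]]|[h|h|[[|k] kr h]]].
- exact: Or31.
- exact: Or32.
- by apply: Or33; exists 0.
- case: k kr kF => [|k]; rewrite mem_iota; first by lia.
  by move=> kr /EF h; apply: Or33; exists k.+1 => //; lia.
- by apply/orP; left; apply/E2'; exact: Or31.
- by apply/orP; left; apply/E2'; exact: Or32.
- by apply/orP; left; apply/E2'; exact: Or33.
- apply/orP; right; apply/hasP; exists k.+1; first by rewrite mem_iota; lia.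
  exact/EF.
Qed.

(** To exclude an edge of ear [k] at the vertices of ear [l], it suffices to know
    how the two pairs of consecutive hubs are placed; what remains is linear
    arithmetic. *)
Variant hub_cmp e k l : Prop :=
| HubLt of (k < l)%N & (hub e k + e.+1 <= hub e l)%N & (hub e k.+1 <= hub e l)%N
    & (hub e k.+1 + e.+1 <= hub e l.+1)%N
| HubEq of k = l
| HubGt of (l < k)%N & (hub e l + e.+1 <= hub e k)%N & (hub e l.+1 <= hub e k)%N
    & (hub e l.+1 + e.+1 <= hub e k.+1)%N.

Lemma hub_cmpP e k l : hub_cmp e k l.
Proof.
case: (ltngtP k l) => [kl|lk|]; last exact: HubEq.
  by apply: HubLt; rewrite ?hub_gap ?leq_hub.
by apply: HubGt; rewrite ?hub_gap ?leq_hub.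
Qed.

Lemma edges_ear_chain e r : (0 < r)%N ->
  ear_chain (fun i j => edges e.+3 r i.+1 j.+1) e r.
Proof.
move=> r_gt0.
have hub1 : hub e 1 = e.+2 by rewrite /hub mul1n.
have gap k : (hub e k + e.+1 <= hub e k.+1)%N by exact: hub_gap.
have ge_hub1 k : (e.+2 <= hub e k.+1)%N by rewrite -hub1 leq_hub.
split.
- apply/negP=> /(edgesP _ _ _ r_gt0)[||[k _]]; try by lia.
  by have h1 := ge_hub1 k; case; lia.
- split => //.
  + move=> t te; rewrite !add0n; split=> [j jt|i it].
      apply/negP=> /(edgesP _ _ _ r_gt0)[||[k _]]; try by lia.
      have := ge_hub1 k; have := gap k; rewrite /ear_edge.
      by case: (hub_cmpP e k 0) => [//|->|? ? ? ?] ? ?; case; rewrite /=; lia.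
    have -> : path_vertex 0 0 t = t by case: t {te it}.
    apply/idP/eqP=> [|it'].
      move/(edgesP _ _ _ r_gt0)=> [||[k _]]; try by lia.
      by have h1 := ge_hub1 k; case; lia.
    by apply/(edgesP _ _ _ r_gt0); apply: Or31; lia.
  + move=> j jt; apply/idP/eqP => [|->].
      move/(edgesP _ _ _ r_gt0)=> [||[k _]]; try by lia.
      by have h1 := ge_hub1 k; case; lia.
    by apply/(edgesP _ _ _ r_gt0); apply: Or32.
  + move=> i jt; rewrite /path_vertex add0n; apply/idP/eqP => [|->].
      move/(edgesP _ _ _ r_gt0)=> [||[k _]]; try by lia.
      by have h1 := ge_hub1 k; case; lia.
    by apply/(edgesP _ _ _ r_gt0); apply: Or31.
move=> s sr; have ge1 := ge_hub1 s; have gaps := gap s; split.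
- by lia.
- move=> t te; split=> [j jt|i it].
    apply/negP=> /(edgesP _ _ _ r_gt0)[||[k _]]; try by lia.
    have := gap k; rewrite /ear_edge.
    by case: (hub_cmpP e k s) => [? ? ? ?|->|? ? ? ?] ?; case; lia.
  apply/idP/eqP => [|it'].
    move/(edgesP _ _ _ r_gt0)=> [||[k _]]; try by lia.
    have := gap k; rewrite /ear_edge.
    by case: (hub_cmpP e k s) => [? ? ? ?|->|? ? ? ?] ?;
      case: t te it => [|t] te it; case; rewrite /path_vertex; lia.
  apply/(edgesP _ _ _ r_gt0); apply: Or33; exists s => //; rewrite it' /ear_edge.
  by case: t te {it it'} => [|t] te; [apply: Or31|apply: Or32]; rewrite /path_vertex; lia.
- move=> j jt; apply/idP/eqP => [|->].
    move/(edgesP _ _ _ r_gt0)=> [||[k _]]; try by lia.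
    have := gap k; rewrite /ear_edge.
    by case: (hub_cmpP e k s) => [? ? ? ?|->|? ? ? ?] ?; case; lia.
  by apply/(edgesP _ _ _ r_gt0); apply: Or33; exists s => //; apply: Or33.
- move=> i it; apply/idP/eqP => [|it'].
    move/(edgesP _ _ _ r_gt0)=> [||[k _]]; try by lia.
    have := gap k; rewrite /ear_edge.
    have [[? ->]|[? ->]] := path_vertexP (hub e s.+1) (hub e s) e;
      by case: (hub_cmpP e k s) => [? ? ? ?|->|? ? ? ?] ?; case; lia.
  apply/(edgesP _ _ _ r_gt0); apply: Or33; exists s => //; rewrite it' /ear_edge.
  have [[? ->]|[? ->]] := path_vertexP (hub e s.+1) (hub e s) e.
    by apply: Or31; lia.
  by apply: Or32; lia.
Qed.

(** * Lowest terms *)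

(** The sign [(-1) ^+ k] of the lowest coefficient is recorded in order to
    exclude cancellation between terms of the same order. *)
Definition lowest_term (p : {poly int}) (a k : nat) : Prop :=
  exists2 q, p = 'X^a * q & 0 < (-1) ^+ k * q`_0.

Lemma lowest_term_Xn a : lowest_term 'X^a a 0.
Proof. by exists 1; rewrite ?mulr1 // coef1. Qed.

Lemma lowest_termXM p a k m :
  lowest_term p a k -> lowest_term ('X^m * p) (m + a) k.
Proof. by move=> [q -> q0]; exists q => //; rewrite mulrA -exprD. Qed.

Lemma lowest_termB p q a k :
  lowest_term p a k.+1 -> lowest_term q a k -> lowest_term (p - q) a k.+1.
Proof.
move=> [p1 -> p0] [q1 -> q0]; exists (p1 - q1); first by rewrite mulrBr.
rewrite coefB mulrBr subr_gt0; apply: lt_trans p0.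
by rewrite exprS mulN1r mulNr oppr_lt0.
Qed.

Lemma lowest_termB_lt p q a b k l : (a < b)%N ->
  lowest_term p b l -> lowest_term q a k -> lowest_term (p - q) a k.+1.
Proof.
move=> ab [p1 -> p0] [q1 -> q0]; exists ('X^(b - a) * p1 - q1).
  by rewrite mulrBr mulrA -exprD subnKC // ltnW.
by rewrite coefB coefXnM subn_gt0 ab sub0r exprS mulN1r mulrNN.
Qed.

Lemma lowest_term_eq p a b k : lowest_term p a k -> a = b -> lowest_term p b k.
Proof. by move=> pa <-. Qed.

(** At the first step the term in [c] has the lower order and determines the
    result; at the second the two terms have the same order and, the sign of the
    first having changed, they add up. *)
Lemma block_lowest_term e q (a b c a1 a2 : {poly int}) :
  a1 = 'X^(e.+1) * a - 'X^e * c -> a2 = 'X^(e.+1) * a1 - 'X^e * b ->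
  lowest_term a (2 * q * e + e + 2) q ->
  lowest_term b (2 * q * e + e + 1) q ->
  lowest_term c (2 * q * e) q ->
  lowest_term a1 (2 * q * e + e) q.+1 /\
  lowest_term a2 (2 * q * e + 2 * e + 1) q.+1.
Proof.
move=> -> -> la lb lc.
have la1 : lowest_term ('X^(e.+1) * a - 'X^e * c) (2 * q * e + e) q.+1.
  rewrite addnC; apply: (@lowest_termB_lt _ _ _ (e.+1 + (2 * q * e + e + 2))).
  - by lia.
  - exact: lowest_termXM la.
  - exact: lowest_termXM lc.
split=> //; apply: lowest_termB.
  by apply: lowest_term_eq (lowest_termXM e.+1 la1) _; lia.
by apply: lowest_term_eq (lowest_termXM e lb) _; lia.
Qed.

(** After the two steps of [block_lowest_term] the third is again one between
    terms of equal order, and it restores the pattern with the signs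
    changed. *)
Lemma det_coefs_lowest_term e q :
  let: (a, b, c) := det_coefs e ('X : {poly int}) (3 * q) in
  [/\ lowest_term a (2 * q * e + e + 2) q,
      lowest_term b (2 * q * e + e + 1) q
    & lowest_term c (2 * q * e) q].
Proof.
elim: q => [|q].
  rewrite muln0 /= muln0 mul0n !add0n addn2 addn1.
  by split; [exact: lowest_term_Xn|exact: lowest_term_Xn|exact: (lowest_term_Xn 0)].
rewrite (_ : (3 * q.+1 = (3 * q).+3)%N) /=; last by lia.
case: det_coefs => [[a b] c] [la lb lc].
have [la1 la2] := block_lowest_term erefl erefl la lb lc; split.
- apply: lowest_termB.
    by apply: lowest_term_eq (lowest_termXM e.+1 la2) _; lia.
  by apply: lowest_term_eq (lowest_termXM e (lowest_termXM e la)) _; lia.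
- by apply: lowest_term_eq (lowest_termXM e la2) _; lia.
- by apply: lowest_term_eq (lowest_termXM e la1) _; lia.
Qed.

(** The values [u = 1], [w = 0], [y = 'X] turn the recursion into ['X * a - c].
    The remainder of [r - 1] modulo 3 tells where in a block of three steps the
    recursion stops: for remainder 0 the order is that of [c], and otherwise
    ['X * a] and [c] have the same order and opposite signs. *)
Lemma Phi_lowest_term n r : (3 <= n)%N -> (0 < r)%N ->
  exists k, lowest_term (Phi n r) (num_vertices n r - n * ((r + 2) %/ 3)) k.
Proof.
move=> n3 r_gt0; have [e ->] : exists e, n = e.+3 by exists (n - 3)%N; lia.
case: r r_gt0 => // r _.
have chain := edges_ear_chain e (ltn0Sn r).
have dimE : num_vertices e.+3 r.+1 = (hub e r.+1).+1.
  by rewrite /num_vertices /hub; nia.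
have -> : Phi e.+3 r.+1 = let: (a, b, c) := det_coefs e 'X r in 'X * a - c.
  transitivity (corner_det (hub e r.+1).+1
    (char_entry (fun i j => edges e.+3 r.+1 i.+1 j.+1) ('X : {poly int}))).
    rewrite -dimE /Phi /char_poly /corner_det; congr (\det _).
    apply/matrixP=> i j; rewrite !mxE /char_entry /Gamma.
    by case: edges; rewrite ?polyC1 ?polyC0.
  rewrite (char_det_chain _ chain) // (last_hub_detE _ _ _ _ chain) //.
  by case: det_coefs => [[a b] c]; ring.
rewrite dimE {dimE chain}.
(* [r] has become [r - 1], the index in [det_coefs]. *)
have [q [i [ri i3]]] : exists q i, r = (3 * q + i)%N /\ (i < 3)%N.
  by exists (r %/ 3)%N, (r %% 3)%N; rewrite ltn_mod mulnC -divn_eq.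
have -> : ((r.+1 + 2) %/ 3 = q.+1)%N by lia.
exists q.+1; have := det_coefs_lowest_term e q; rewrite ri.
case: i i3 {ri} => [|[|[|//]]] _;
  rewrite ?(addn0 (3 * q)) ?(addn1 (3 * q)) ?(addn2 (3 * q)) /=.
- case: det_coefs => [[a b] c] [la lb lc].
  rewrite (_ : (_ - _)%N = 2 * q * e)%N; last by rewrite /hub; nia.
  by apply: lowest_termB_lt (lowest_termXM 1 la) lc; lia.
- case: det_coefs => [[a b] c] [la lb lc].
  have [la1 _] := block_lowest_term erefl erefl la lb lc.
  apply: lowest_termB.
    by apply: lowest_term_eq (lowest_termXM 1 la1) _; rewrite /hub; nia.
  by apply: lowest_term_eq lb _; rewrite /hub; nia.
- case: det_coefs => [[a b] c] [la lb lc].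
  have [_ la2] := block_lowest_term erefl erefl la lb lc.
  apply: lowest_termB.
    by apply: lowest_term_eq (lowest_termXM 1 la2) _; rewrite /hub; nia.
  by apply: lowest_term_eq (lowest_termXM e la) _; rewrite /hub; nia.
Qed.

Lemma lowest_term_ordX p a k : lowest_term p a k -> ordX p = a.
Proof.
move=> [q -> q0]; have q0n : q`_0 != 0.
  by apply: contraTneq q0 => ->; rewrite mulr0 ltxx.
have pa : ('X^a * q)`_a != 0 by rewrite coefXnM ltnn subnn.
rewrite /ordX; apply/eqP; rewrite eqn_leq; apply/andP; split.
  by rewrite leqNgt; apply/negP=> /(before_find 0); rewrite pa.
rewrite leqNgt; apply/negP=> lt_fa; move: (lt_fa); apply/negP.
have lt_a : (a < size ('X^a * q)%R)%N.
  by rewrite ltnNge; apply: contraNN pa => /(nth_default 0) ->.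
have /(nth_find 0) : has (fun c : int => c != 0) ('X^a * q)%R.
  by rewrite has_find; apply: ltn_trans lt_fa _.
by rewrite coefXnM lt_fa eqxx.
Qed.

Lemma lowest_term_mup p a k :
  lowest_term p a k -> mup 0 (map_poly intr p : {poly algC}) = a.
Proof.
move=> [q -> q0]; have q0n : q`_0 != 0.
  by apply: contraTneq q0 => ->; rewrite mulr0 ltxx.
rewrite rmorphM /= map_polyXn mupMl; last first.
  by rewrite /root horner_coef0 coef_map /= intr_eq0.
have -> : 'X = 'X - 0%:P :> {poly algC} by rewrite polyC0 subr0.
by rewrite mup_XsubCX eqxx.
Qed.

Theorem proposition4p2 (n r : nat) (hn : (3 <= n)%N) (hr : (1 <= r)%N) :
  let m : nat := ordX (Phi n r) in
  alg_mult 0 (map_mx intr (adjacency n r) : 'M[algC]_(num_vertices n r)) = m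
  /\ m%:Z = r%:Z * n%:Z - 2 * r%:Z + 2 - n%:Z * ((r + 2) %/ 3)%N%:Z
  /\ (r = 1 %[mod 3] ->
        m%:R = 1 / 3 * (2 * n%:R - 6) * (r%:R - 1) :> rat)
  /\ (r = 2 %[mod 3] ->
        m%:R = 1 / 3 * (2 * n%:R - 6) * (r%:R - 2) + (n%:R - 2) :> rat)
  /\ (r = 0 %[mod 3] ->
        m%:R = 1 / 3 * (2 * n%:R - 6) * (r%:R - 3) + 2 * (n%:R - 2) :> rat).
Proof.
have [k low] := Phi_lowest_term hn hr.
have [e nE] : exists e, n = e.+3 by exists (n - 3)%N; lia.
move=> m; have mE : m = (num_vertices n r - n * ((r + 2) %/ 3))%N.
  exact: lowest_term_ordX low.
split; first by rewrite /alg_mult -map_char_poly mE; apply: lowest_term_mup low.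
clearbody m; rewrite /num_vertices in mE.
have [q [i [ri i3]]] : exists q i, r = (3 * q + i.+1)%N /\ (i < 3)%N.
  by exists (r.-1 %/ 3)%N, (r.-1 %% 3)%N; lia.
have q3 : ((r + 2) %/ 3 = q.+1)%N by lia.
have {k low} mE' : m = (2 * q * e + i * e.+1)%N.
  by rewrite mE q3 ri nE; move: i3; case: (i) => [|[|[|//]]] _; nia.
rewrite q3 {mE}; split; first by rewrite mE' ri nE; lia.
have ratE : m%:R = 2 * q%:R * (n%:R - 3) + i%:R * (n%:R - 2) :> rat.
  by rewrite mE' nE -addn3 -[e.+1]addn1 !natrD !natrM natrD; ring.
have rR : r%:R = 3 * q%:R + i%:R + 1 :> rat.
  by rewrite ri natrD natrM -[i.+1]addn1 natrD; ring.
split; [|split] => rmod; rewrite ratE rR.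
- by rewrite (_ : i = 0); [field|lia].
- by rewrite (_ : i = 1); [field|lia].
- by rewrite (_ : i = 2); [field|lia].
Qed.
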